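(* Let $X$ be a normed linear space and $Y$ a Banach space. Let $S:X\rightrightarrows Y$ be locally closed at $(\bar x,\bar y)\in\mathrm{gph}(S)$, and let $H:X\rightrightarrows Y$ be positively homogeneous. Consider the statements: (1) $S$ is pseudo strictly $H$-differentiable at $(\bar x,\bar y)$. (2) For all $\delta>0$, there are neighborhoods $U$ of $\bar x$ and $V$ of $\bar y$ such that $$DS(x\mid y)(p)\cap[-(H+\delta)(-p)]\neq\emptyset\quad\text{for all }(x,y)\in\mathrm{gph}(S)\cap[U\times V]\text{ and }p\in X\setminus\{0\}.$$ (2$'$) For all $\delta>0$, there are neighborhoods $U$ of $\bar x$ and $V$ of $\bar y$ such that $$D^{\star\star}S(x\mid y)(p)\cap[-(H+\delta)(-p)]\neq\emptyset\quad\text{for all }(x,y)\in\mathrm{gph}(S)\cap[U\times V]\text{ and }p\in X\setminus\{0\}.$$ Then the following hold: (a) If $Y$ is finite dimensional and $H$ is compact-valued, then (1) implies (2). (b) If $\|H\|^{+}<\infty$, $H$ is convex-valued and $X$ is complete, then (2) implies (1). (c) If both $X$ and $Y$ are finite dimensional Euclidean spaces and $H$ is a prefan, then (1), (2) and (2$'$) are equivalent.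
   Context: A set-valued map $S:X\rightrightarrows Y$ assigns to each $x\in X$ a subset $S(x)\subset Y$ (possibly empty); its graph is $\mathrm{gph}(S)=\{(x,y)\mid y\in S(x)\}\subset X\times Y$. $S$ is locally closed at $(\bar x,\bar y)\in\mathrm{gph}(S)$ if $\mathrm{gph}(S)\cap\mathbb{B}_\epsilon((\bar x,\bar y))$ is closed for some $\epsilon>0$, where $\mathbb{B}_\epsilon(z)$ is the closed ball of radius $\epsilon$ centered at $z$; $\mathbb{B}$ is the closed unit ball. A map is compact-valued (convex-valued) if each of its values is compact (convex). $H:X\rightrightarrows Y$ is positively homogeneous if $0\in H(0)$ and $H(kw)=kH(w)$ for all $k>0$, $w\in X$. For a real $\delta>0$, $(H+\delta)(w):=H(w)+\delta\|w\|\mathbb{B}$. The outer norm is $\|H\|^{+}:=\sup_{\|w\|\le1}\sup_{z\in H(w)}\|z\|$. A prefan (between finite dimensional Euclidean spaces) is a positively homogeneous map $H$ such that $H(p)$ is nonempty, convex and compact for all $p$, and $\|H\|^{+}$ is finite. $S$ is pseudo strictly $H$-differentiable at $(\bar x,\bar y)\in\mathrm{gph}(S)$ if for any $\delta>0$ there are neighborhoods $U_\delta$ of $\bar x$ and $V_\delta$ of $\bar y$ such that $S(x)\cap V_\delta\subset S(x')+(H+\delta)(x-x')$ for all $x,x'\in U_\delta$. For a subset $C$ of a normed space and $\bar z\in C$, the tangent (contingent) cone $T_C(\bar z)$ is the set of $w$ such that $(z_i-\bar z)/\tau_i\to w$ for some $z_i\to\bar z$, $z_i\in C$, $\tau_i\searrow0$.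 For $(x,y)\in\mathrm{gph}(S)$, the graphical derivative $DS(x\mid y):X\rightrightarrows Y$ is defined by $\mathrm{gph}(DS(x\mid y))=T_{\mathrm{gph}(S)}(x,y)$, and the convexified graphical derivative $D^{\star\star}S(x\mid y):X\rightrightarrows Y$ by $\mathrm{gph}(D^{\star\star}S(x\mid y))=\mathrm{cl}\,\mathrm{co}\,T_{\mathrm{gph}(S)}(x,y)$ (closed convex hull). *)

(* Defs.v *)
From HB Require Import structures.
From mathcomp Require Import all_boot all_order all_algebra.
From mathcomp Require Import all_classical all_reals all_analysis.

Set Implicit Arguments.
Unset Strict Implicit.
Unset Printing Implicit Defensive.

Import Order.TTheory GRing.Theory Num.Theory.
Import numFieldNormedType.Exports.

Local Open Scope classical_set_scope.
Local Open Scope ring_scope.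

Section Spaces.
Context {R : realType}.

(* Completeness as a property of a normed space: the axiom of completeType. *)
Definition complete_space (V : normedModType R) : Prop :=
  forall F : set_system V, ProperFilter F -> cauchy F -> cvg F.

Definition finite_dimensional (V : lmodType R) : Prop :=
  exists (n : nat) (e : 'I_n -> V),
    forall v : V, exists c : 'I_n -> R, v = \sum_(i < n) c i *: e i.

(* The norm must come from an inner product: the library norm on row vectors
   is the sup norm, so 'rV[R]_n itself is not an instance for n > 1. *)
Definition euclidean (V : normedModType R) : Prop :=
  finite_dimensional V /\
  exists dot : {dot V for (@idfun R)}, forall v : V, `|v| ^+ 2 = dot v v.

Definition unit_ball (V : normedModType R) : set V :=
  closed_ball_ Num.norm 0 1.

Definition minkowski_sum (V : zmodType) (A B : set V) : set V :=
  [set a + b | a in A & b in B].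

(* [tau_i \searrow 0] is read as [tau_i > 0] and [tau_i --> 0]. *)
Definition tangent_cone (V : normedModType R) (C : set V) (zbar : V) : set V :=
  [set w | exists (z : nat -> V) (tau : nat -> R),
    [/\ forall i, C (z i),
        z @ \oo --> zbar,
        forall i, 0 < tau i,
        tau @ \oo --> (0 : R) &
        (fun i => (tau i)^-1 *: (z i - zbar)) @ \oo --> w]].

Definition convex_hull (V : lmodType R) (A : set V) : set V :=
  smallest (@convex_set R V) A.

End Spaces.

Section SetValuedMaps.
Context {R : realType} {X Y : normedModType R}.
Implicit Types S H : X -> set Y.

Definition gph S : set (X * Y) := [set z | S z.1 z.2].

(* [X * Y] carries the library's max norm. *)
Definition locally_closed S (xbar : X) (ybar : Y) : Prop :=
  exists2 e : R, 0 < e &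
    closed (gph S `&` closed_ball_ Num.norm (xbar, ybar) e).

Definition compact_valued S : Prop := forall x, compact (S x).

Definition convex_valued S : Prop := forall x, @convex_set R Y (S x).

Definition pos_homogeneous H : Prop :=
  H 0 0 /\
  forall (k : R) (w : X), 0 < k -> H (k *: w) = [set k *: z | z in H w].

Definition fatten H (delta : R) : X -> set Y :=
  fun w => minkowski_sum (H w) [set (delta * `|w|) *: b | b in @unit_ball R Y].

Definition outer_norm H : \bar R :=
  ereal_sup [set ereal_sup [set `|z|%:E | z in H w] | w in @unit_ball R X].

Definition prefan H : Prop :=
  [/\ pos_homogeneous H,
      forall p, H p !=set0,
      convex_valued H,
      compact_valued H &
      outer_norm H \is a fin_num].

Definition pseudo_strictly_differentiable S H (xbar : X) (ybar : Y) : Prop :=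
  forall delta : R, 0 < delta ->
    exists (U : set X) (V : set Y),
      [/\ nbhs xbar U,
          nbhs ybar V &
          forall x x', U x -> U x' ->
            S x `&` V `<=` minkowski_sum (S x') (fatten H delta (x - x'))].

Definition graphical_derivative S (x : X) (y : Y) : X -> set Y :=
  fun p => [set q | tangent_cone (gph S) (x, y) (p, q)].

Definition convexified_graphical_derivative S (x : X) (y : Y) : X -> set Y :=
  fun p => [set q |
    closure (convex_hull (tangent_cone (gph S) (x, y))) (p, q)].

(* [D x y] stands for one of the two derivatives above at [(x, y)]. *)
Definition derivative_criterion (D : X -> Y -> X -> set Y) S H
    (xbar : X) (ybar : Y) : Prop :=
  forall delta : R, 0 < delta ->
    exists (U : set X) (V : set Y),
      [/\ nbhs xbar U,
          nbhs ybar V &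
          forall (x : X) (y : Y) (p : X),
            (gph S `&` (U `*` V)) (x, y) -> p != 0 ->
            D x y p `&` [set - z | z in fatten H delta (- p)] !=set0].

End SetValuedMaps.

(* Main.v *)
Require Import Defs.
From HB Require Import structures.
From mathcomp Require Import all_boot all_order all_algebra.
From mathcomp Require Import all_classical all_reals all_analysis.
From mathcomp Require Import ring lra.

(** Graphically, (2) says that the convex set [K = {p} x -(H + delta)(-p)] meets
    the tangent cone of [gph S] at every nearby point.

    (1) => (2): the difference quotients of (1) along [x + t p] lie in a compact
    set, so they have a cluster point.

    (2) => (1): by Ekeland's principle on (time, position) pairs one can follow
    [K] inside [gph S] for unit time, up to an arbitrarily small error.  The
    endpoint misses the abscissa [x'] by little; as [H] is uncontrolled off the
    direction [p] except for its bound, a second application of Ekeland's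
    principle, to the function [(u, v) |-> |x' - u|], repairs this at a cost
    proportional to the error.

    (2') => (2): project onto the graph.  If [c] is a nearest point to
    [x = z + t k], [k] in [K], then [x - c] makes an obtuse angle with the
    closed convex hull of the tangent cone at [c], hence with some [q] in [K],
    and [|x + h q - c|^2 <= |x - c|^2 + h^2 |q|^2].  With [n] steps of size
    [T / n] the squared distance to the graph is at most [T^2 |K|^2 / n], so the graph
    meets [z + T K] approximately for every small [T], and (2) follows by
    compactness. *)

Set Implicit Arguments.
Unset Strict Implicit.
Unset Printing Implicit Defensive.

Import Order.TTheory GRing.Theory Num.Theory.
Import numFieldNormedType.Exports.

Local Open Scope classical_set_scope.
Local Open Scope ring_scope.

(** * Convex combinations *)

(** The weights are left unnormalised: later they are durations or numbers of steps spent along [k]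
    and [l]. *)
Lemma convex_comb (R : realType) (V : lmodType R) (K : set V) (k l : V)
    (a b : R) :
  @convex_set R V K -> K k -> K l -> 0 <= a -> 0 <= b -> 0 < a + b ->
  K ((a / (a + b)) *: k + (b / (a + b)) *: l).
Proof.
move=> cK Kk Kl a0 b0 ab0.
have p0 : 0 <= a / (a + b) by rewrite divr_ge0// ltW.
have p1 : a / (a + b) <= 1 by rewrite ler_pdivrMr// mul1r lerDl.
have p01 : Itv.spec (@Itv.num_sem R) (Itv.Real `[0%Z, 1%Z]) (a / (a + b)).
  by apply/andP; split; [exact: ger0_real|rewrite /= in_itv/= p0 p1].
pose p : {i01 R} := Itv.mk p01.
have := cK k l p; rewrite !inE => /(_ Kk Kl).
rewrite /conv/=; congr (K (_ + _ *: _)).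
by apply: (mulIf (lt0r_neq0 ab0)); rewrite mulrBl !divfK ?gt_eqF// mul1r addrC
  addKr.
Qed.

Lemma convex_setP (R : realType) (V : lmodType R) (K : set V) :
  (forall (k l : V) (a : R), K k -> K l -> 0 <= a <= 1 ->
    K (a *: k + (1 - a) *: l)) -> @convex_set R V K.
Proof.
move=> H k l p /set_mem Kk /set_mem Kl; apply/mem_set; apply: H => //.
by rewrite ge0 le1.
Qed.

(** * Tangent cones *)

Section tangent_cone.
Context {R : realType} {V : normedModType R}.
Implicit Types (C K : set V) (z w : V).

(** Sequence-free form, in which one [e] bounds both the step and the relative error; sequences come
    back by choosing a point for each [e = harmonic n]. *)
Lemma tangent_coneP C z w : tangent_cone C z w <->
  forall e, 0 < e -> exists t z',
    [/\ 0 < t, t < e, C z' & `|z' - z - t *: w| <= e * t].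
Proof.
split=> [[u [tau [Cu uz tau0 tauc uw]]] e e0|H].
  move/cvgrPdist_lt : tauc => /(_ _ e0) tauc.
  move/cvgrPdist_le : uw => /(_ _ e0) uw.
  have [n [tn un]] : exists n, `|0 - tau n| < e /\
      `|w - (tau n)^-1 *: (u n - z)| <= e.
    near \oo => n; exists n; split; near: n; [exact: tauc|exact: uw].
  exists (tau n), (u n); split => //.
    by rewrite sub0r normrN gtr0_norm in tn.
  have -> : u n - z - tau n *: w = - (tau n *: (w - (tau n)^-1 *: (u n - z))).
    by rewrite scalerBr scalerA divff ?gt_eqF// scale1r opprB.
  by rewrite normrN normrZ gtr0_norm// mulrC ler_pM2r.
have {}H (n : nat) : exists tz : R * V, [/\ 0 < tz.1, tz.1 < harmonic n, C tz.2
    & `|tz.2 - z - tz.1 *: w| <= harmonic n * tz.1].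
  have [|t [z' ?]] := H (harmonic n); first exact: harmonic_gt0.
  by exists (t, z').
have {H}[f fP] := choice H.
have f0 : (fun n => (f n).1) @ \oo --> (0 : R).
  apply: (@squeeze_cvgr _ _ _ _ (fun=> 0) (@harmonic R)).
  - by near=> n; have [/ltW -> /ltW ->] := fP n.
  - exact: cvg_cst.
  - exact: cvg_harmonic.
have fw : (fun n => (f n).1^-1 *: ((f n).2 - z)) @ \oo --> w.
  apply/subr_cvg0/norm_cvg0P.
  apply: (@squeeze_cvgr _ _ _ _ (fun=> 0) (@harmonic R)).
  - near=> n; have [f1 _ _ fn] := fP n; rewrite normr_ge0/=.
    have -> : (f n).1^-1 *: ((f n).2 - z) - w =
        (f n).1^-1 *: ((f n).2 - z - (f n).1 *: w).
      by rewrite [RHS]scalerBr scalerA mulVf ?gt_eqF// scale1r.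
    by rewrite normrZ normfV gtr0_norm// mulrC ler_pdivrMr.
  - exact: cvg_cst.
  - exact: cvg_harmonic.
exists (fun n => (f n).2), (fun n => (f n).1); split => //.
- by move=> n; have [] := fP n.
(* Convergence of the points to [z] follows from the other two limits: each point is [z] plus its
   step times its difference quotient. *)
- have -> : (fun n => (f n).2) =
      (fun n => (f n).1 *: ((f n).1^-1 *: ((f n).2 - z)) + z).
    apply/funext => n; have [f1 _ _ _] := fP n.
    by rewrite scalerA divff ?gt_eqF// scale1r subrK.
  rewrite -[X in _ --> X]add0r -[X in X + z](scale0r w).
  by apply: cvgD; [exact: cvgZ|exact: cvg_cst].
- by move=> n; have [] := fP n.
Unshelve. all: by end_near. Qed.

Lemma tangent_cone_subset C C' z : C `<=` C' ->
  tangent_cone C z `<=` tangent_cone C' z.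
Proof.
by move=> CC' w [u [t [Cu ? ? ? ?]]]; exists u, t; split=> // i; exact: CC'.
Qed.

Lemma tangent_coneI_nbhs C B z : nbhs z B ->
  tangent_cone (C `&` B) z = tangent_cone C z.
Proof.
move=> zB; apply/seteqP; split => w; first exact: tangent_cone_subset.
move=> /tangent_coneP Cw; apply/tangent_coneP => e e0.
move/nbhs_ballP: zB => [r /= r0 zB].
(* Then [t * (|w| + e + 1) < r], while [z'] lies within [t * (|w| + e)] of [z], hence in the
   ball. *)
pose d := Num.min e (r / (`|w| + e + 1)).
have we0 : 0 < `|w| + e + 1 by rewrite ltr_wpDl// addr_ge0// ltW.
have d0 : 0 < d by rewrite lt_min e0 divr_gt0.
have [t [z' [t0 td Cz' z't]]] := Cw d d0.
exists t, z'; move: td; rewrite lt_min => /andP[te tr].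
have z'e : `|z' - z - t *: w| <= e * t.
  by rewrite (le_trans z't)// ler_pM2r// ge_min lexx.
split=> //; split => //; apply: zB; rewrite -ball_normE /ball_/= distrC.
have -> : z' - z = (z' - z - t *: w) + t *: w by rewrite subrK.
rewrite (le_lt_trans (ler_normD _ _))// normrZ gtr0_norm//.
move: tr; rewrite ltr_pdivlMr// => tr.
rewrite (le_lt_trans (lerD z'e (lexx _)))//.
rewrite (le_lt_trans _ tr)// !mulrDr mulr1; nra.
Qed.

(** The directions may vary with [e]; they cluster at some [k] in [K], and replacing a nearby
    direction by [k] changes the error only by [t] times their distance. *)
Lemma compact_meets_tangent_cone C K z : compact K ->
  (forall e, 0 < e -> exists t z' k,
    [/\ 0 < t < e, C z', K k & `|z' - z - t *: k| <= e * t]) ->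
  K `&` tangent_cone C z !=set0.
Proof.
move=> cK H.
have {}H (n : nat) : exists f : R * V * V, [/\ 0 < f.1.1 < harmonic n, C f.1.2,
    K f.2 & `|f.1.2 - z - f.1.1 *: f.2| <= harmonic n * f.1.1].
  have [|t [z' [k ?]]] := H (harmonic n); first exact: harmonic_gt0.
  by exists (t, z', k).
have {H}[f fP] := choice H.
have [|k [Kk clk]] := cK ((fun n => (f n).2) @ \oo) _.
  by exists 0 => // n _; have [] := fP n.
exists k; split => //; apply/tangent_coneP => e e0.
have e20 : 0 < e / 2 by rewrite divr_gt0.
have /cvgrPdist_lt/(_ _ e20)[N _ harm] := @cvg_harmonic R.
(* The cluster point is tested against the tail of indices at least [N], so that closeness to [k]
   and smallness of [harmonic n] hold at the same [n]. *)
have [||_ [[n /= Nn <-] kn]] :=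
  clk [set (f n).2 | n in [set n | (N <= n)%N]] (ball k (e / 2)).
  by exists N => // n /= Nn; exists n.
  exact: nbhsx_ballx.
have [/andP[t0 tn] Cn Kn fn] := fP n.
have hn : harmonic n < e / 2.
  by have := harm n Nn; rewrite sub0r normrN ger0_norm// harmonic_ge0.
exists (f n).1.1, (f n).1.2; split => //.
  by rewrite (lt_trans tn)// (lt_trans hn)//; lra.
have -> : (f n).1.2 - z - (f n).1.1 *: k =
    ((f n).1.2 - z - (f n).1.1 *: (f n).2) - (f n).1.1 *: (k - (f n).2).
  by rewrite scalerBr opprB addrA subrK.
rewrite (le_trans (ler_normB _ _))// normrZ gtr0_norm//.
move: kn; rewrite -ball_normE /ball_/= => kn.
have := ltW kn; have := ltW hn; nra.
Qed.

End tangent_cone.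

(** * A variational principle *)

(* Ekeland's principle in the ordering form of Brezis and Browder: [phi] is not
   assumed semicontinuous, the closedness of the order takes over that role. *)
Lemma maximal_element (R : realType) (V : normedModType R) (A : set V)
    (le : V -> V -> Prop) (phi : V -> R) (m : R) :
  complete_space V -> closed A ->
  (forall z, A z -> le z z) ->
  (forall x y z, A x -> A y -> A z -> le x y -> le y z -> le x z) ->
  (forall z z', A z -> A z' -> le z z' -> `|z' - z| <= phi z - phi z') ->
  (forall z, A z -> m <= phi z) ->
  (forall z l, A z -> A l ->
    (forall e, 0 < e -> exists z', [/\ A z', le z z' & `|z' - l| <= e]) ->
    le z l) ->
  forall z0, A z0 -> exists z, [/\ A z, le z0 z &
    forall z', A z' -> le z z' -> z' = z].
Proof.
move=> cV clA rle tle dle mphi cle z0 Az0.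
have ple z z' : A z -> A z' -> le z z' -> phi z' <= phi z.
  by move=> Az Az' /(dle _ _ Az Az') h; rewrite -subr_ge0 (le_trans _ h).
(* The successor brings [phi] at least halfway down to its infimum over the points above the current
   one. *)
have step (s : {z | A z}) : exists s' : {z | A z}, le (sval s) (sval s') /\
    forall z'', A z'' -> le (sval s) z'' ->
      phi (sval s') * 2 <= phi (sval s) + phi z''.
  case: s => z Az /=.
  pose E := [set phi z' | z' in [set z' | A z' /\ le z z']].
  have infE : has_inf E.
    split; first by exists (phi z), z => //; split=> //; exact: rle.
    by exists m => _ [z' [Az' _] <-]; exact: mphi.
  have [zE|zE] := leP (phi z) (inf E).
    exists (exist _ z Az); split=> /=; first exact: rle.
    move=> z'' Az'' zz''; have : inf E <= phi z''.
      by apply: ge_inf; [exact: infE.2|exists z''].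
    by move: zE; lra.
  have [|_ [z' [Az' zz'] <-] z'E] := @inf_adherent _ E ((phi z - inf E) / 2) _
    infE.
    by rewrite divr_gt0// subr_gt0.
  exists (exist _ z' Az'); split=> //= z'' Az'' zz''.
  have : inf E <= phi z'' by apply: ge_inf; [exact: infE.2|exists z''].
  by move: z'E; lra.
have [nxt nxtP] := choice step.
pose s n := iter n nxt (exist _ z0 Az0).
pose u n := sval (s n).
have Au n : A (u n) by exact: svalP.
have uS n : le (u n) (u n.+1) by rewrite /u /=; exact: (nxtP (s n)).1.
have le_u n k : le (u n) (u (n + k)%N).
  elim: k => [|k IH]; first by rewrite addn0; exact: rle.
  by rewrite addnS; apply: (tle _ (u (n + k)%N)).
have niphi : nonincreasing_seq (phi \o u).
  by apply/nonincreasing_seqP => n /=; exact: ple.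
have cphi : cvgn (phi \o u).
  apply: nonincreasing_is_cvgn => //.
  by exists m => _ [n _ <-] /=; exact: mphi.
pose L := limn (phi \o u).
have Lphi n : L <= phi (u n) by exact: nonincreasing_cvgn_ge.
(* Displacements are dominated by drops of [phi] along the orbit, which tend to zero; this makes [u]
   Cauchy. *)
have du n k : `|u (n + k)%N - u n| <= phi (u n) - L.
  by rewrite (le_trans (dle _ _ _ _ (le_u n k)))// lerB.
have phiL e : 0 < e -> exists n, phi (u n) <= L + e.
  move=> e0; move/cvgrPdist_le : cphi => /(_ _ e0) [n _ /(_ n (leqnn _))]/=.
  by rewrite distrC ler_distl => /andP[_ ?]; exists n.
have [l ul] : exists l : V, u @ \oo --> l.
  have : cvg (u @ \oo).
    apply: cV; apply/cauchyP => e e0.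
    have [|n un] := phiL (e / 2); first by rewrite divr_gt0.
    exists (u n); exists n => // k /= nk; rewrite -ball_normE /ball_/= distrC.
    rewrite -(subnKC nk) (le_lt_trans (du _ _))//; lra.
  by move=> /cvg_ex[l ul]; exists l.
have Al : A l.
  by apply: (closed_cvg _ clA _ _ ul); near=> n; exact: Au.
have ule n : le (u n) l.
  apply: cle => // e e0.
  move/cvgrPdist_le : ul => /(_ _ e0) [k _ ul].
  exists (u (n + k)%N); split => //.
  by rewrite distrC; apply: ul; rewrite /= leq_addl.
exists l; split => //; first exact: (ule 0).
move=> z' Az' lz'.
have phil : phi l <= L.
  apply/ler_addgt0Pr => e e0; have [n un] := phiL e e0.
  exact: (le_trans (ple _ _ _ _ (ule n))).
(* A point above [l] is above every [u n], so the halfway property gives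
   [2 * L <= phi (u n) + phi z']. *)
have phiz' : L <= phi z'.
  apply/ler_addgt0Pr => e e0; have [n un] := phiL e e0.
  have := (nxtP (s n)).2 z' Az' (tle _ _ _ (Au n) Al Az' (ule n) lz').
  rewrite -/(u n) -[sval _]/(u n.+1).
  by have := Lphi n.+1; lra.
apply/eqP; rewrite -subr_eq0 -normr_le0 (le_trans (dle _ _ _ _ lz'))//.
by rewrite subr_le0 (le_trans phil).
Unshelve. all: by end_near. Qed.

(** * Norm and completeness of products *)

Lemma prod_norm_le (R : realType) (V W : normedModType R) (z : V * W) (r : R) :
  (`|z| <= r) = (`|z.1| <= r) && (`|z.2| <= r).
Proof. by rewrite [`|z|]prod_normE ge_max. Qed.

Lemma prod_norm_lt (R : realType) (V W : normedModType R) (z : V * W) (r : R) :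
  (`|z| < r) = (`|z.1| < r) && (`|z.2| < r).
Proof. by rewrite [`|z|]prod_normE gt_max. Qed.

Lemma complete_spaceR (R : realType) : @complete_space R R.
Proof. by move=> F PF; exact: cauchy_cvg. Qed.

Lemma complete_space_prod (R : realType) (V W : normedModType R) :
  complete_space V -> complete_space W -> complete_space (V * W)%type.
Proof.
move=> cV cW F PF cF.
have c1 : cauchy (fst @ F).
  apply/cauchyP => e e0; have /cauchyP/(_ e e0)[z Fz] := cF.
  exists z.1; suff : F (fst @^-1` ball z.1 e) by [].
  by apply: filterS Fz => y [].
have c2 : cauchy (snd @ F).
  apply/cauchyP => e e0; have /cauchyP/(_ e e0)[z Fz] := cF.
  exists z.2; suff : F (snd @^-1` ball z.2 e) by [].
  by apply: filterS Fz => y [].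
have /cvg_ex[a Fa] : cvg (fst @ F) by exact: cV.
have /cvg_ex[b Fb] : cvg (snd @ F) by exact: cW.
apply/cvg_ex; exists (a, b).
move=> B abB.
have : F [set z | B (z.1, z.2)] by exact: (cvg_pair Fa Fb abB).
by apply: filterS => -[].
Qed.

(** * Motion inside a closed set along tangent directions *)

Section trajectories.
Context {R : realType} {V : normedModType R}.

(** A pair [q] follows [p] when the mean velocity between them is within [e] of [K]. Convexity of
    [K] makes this transitive, and a pair stopped before time [t] is extended by a tangent
    direction. The speed bound [N + e] keeps all positions within [r] of [z0]. *)
Lemma approximate_trajectory (C K : set V) (z0 : V) (N r e t : R) :
  complete_space V -> closed C -> @convex_set R V K ->
  (forall k, K k -> `|k| <= N) -> 0 <= N -> 0 < e ->
  (forall z, C z -> `|z - z0| < r -> K `&` tangent_cone C z !=set0) ->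
  C z0 -> 0 < t -> t * (N + e) < r ->
  exists z k, [/\ C z, K k & `|z - z0 - t *: k| <= e * t].
Proof.
move=> cV clC cK KN N0 e0 CK Cz0 t0 tr.
(* The order below tolerates any slack [eta > 0], which lets it pass to limits. Working with [e / 2]
   leaves room [e / 2 * t] to absorb the slack at the end. *)
wlog suff H : e e0 tr / exists z, C z /\ forall eta, 0 < eta ->
    exists2 k, K k & `|z - z0 - t *: k| <= e * t + eta.
  have e20 : 0 < e / 2 by rewrite divr_gt0.
  have [|z [Cz zP]] := H _ e20.
    by rewrite (le_lt_trans _ tr)// ler_pM2l// lerD2l; lra.
  have [|k Kk zk] := zP (e / 2 * t); first exact: mulr_gt0.
  by exists z, k; split => //; rewrite (le_trans zk)//; lra.
have Ne0 : 0 < N + e by rewrite ltr_wpDl.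
have [k0 [Kk0 _]] : K `&` tangent_cone C z0 !=set0.
  apply: CK => //; rewrite subrr normr0 (lt_trans _ tr)// mulr_gt0//.
(* Pairs (time, position): a maximal one must have reached the final time. *)
pose A := [set p : R * V | [/\ 0 <= p.1, p.1 <= t, C p.2 &
  `|p.2 - z0| <= (N + e) * p.1]].
pose le (p q : R * V) := [/\ p.1 <= q.1,
  `|q.2 - p.2| <= (N + e) * (q.1 - p.1) &
  forall eta, 0 < eta -> exists2 k, K k &
    `|q.2 - p.2 - (q.1 - p.1) *: k| <= e * (q.1 - p.1) + eta].
have clA : closed A.
  have -> : A = fst @^-1` [set s | 0 <= s] `&` fst @^-1` [set s | s <= t] `&`
      snd @^-1` C `&`
      (fun p => (N + e) * p.1 - `|p.2 - z0|) @^-1` [set s | 0 <= s].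
    apply/seteqP; split => p /=; rewrite subr_ge0; first by case.
    by move=> [[[? ?] ?] ?].
  apply: closedI; first apply: closedI; first apply: closedI.
  - by apply: closed_comp => [p _|]; [exact: cvg_fst|exact: closed_ge].
  - by apply: closed_comp => [p _|]; [exact: cvg_fst|exact: closed_le].
  - by apply: closed_comp => [p _|]; [exact: cvg_snd|].
  - apply: closed_comp => [p _|]; last exact: closed_ge.
    apply: cvgB; first by apply: cvgM; [exact: cvg_cst|exact: cvg_fst].
    by apply: cvg_norm; apply: cvgB; [exact: cvg_snd|exact: cvg_cst].
have leA p : A p -> le p p.
  move=> _; split => //; first by rewrite !subrr normr0 mulr0.
  by move=> eta eta0; exists k0 => //; rewrite !subrr scale0r subr0 normr0
    mulr0 add0r ltW.
have letr p q s : A p -> A q -> A s -> le p q -> le q s -> le p s.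
  move=> _ _ _ [pq1 pq2 pq3] [qs1 qs2 qs3].
  have Es : s.2 - p.2 = (s.2 - q.2) + (q.2 - p.2) by rewrite addrA subrK.
  have ps2 : `|s.2 - p.2| <= (N + e) * (s.1 - p.1).
    by rewrite Es (le_trans (ler_normD _ _))//; lra.
  have ps1 := le_trans pq1 qs1.
  split => // eta eta0.
  (* When no time elapses the speed bound forces zero displacement, and any direction serves. *)
  have [ps|ps] := eqVneq p.1 s.1.
    exists k0 => //; rewrite ps subrr scale0r subr0 mulr0 add0r.
    by rewrite (le_trans ps2)// ps subrr mulr0 ltW.
  have {}ps : 0 < s.1 - p.1 by rewrite subr_gt0 lt_neqAle ps.
  have eta20 : 0 < eta / 2 by rewrite divr_gt0.
  have [k Kk pqk] := pq3 _ eta20; have [l Kl qsl] := qs3 _ eta20.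
  pose a := q.1 - p.1; pose b := s.1 - q.1.
  have abE : a + b = s.1 - p.1 by rewrite /a /b; lra.
  have a0 : 0 <= a by rewrite subr_ge0.
  have b0 : 0 <= b by rewrite subr_ge0.
  have ab0 : 0 < a + b by rewrite abE.
  exists ((a / (a + b)) *: k + (b / (a + b)) *: l); first exact: convex_comb.
  rewrite -abE scalerDr !scalerA ![(a + b) * _]mulrC !divfK ?gt_eqF//.
  have -> : s.2 - p.2 - (a *: k + b *: l) =
      (q.2 - p.2 - a *: k) + (s.2 - q.2 - b *: l).
    by rewrite Es opprD [s.2 - q.2 + _]addrC [RHS]addrACA.
  rewrite (le_trans (ler_normD _ _))// (le_trans (lerD pqk qsl))//.
  by rewrite -/a -/b; lra.
(* In the max norm a pair moves by at most [N + e + 1] per unit of time, hence the choice of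
   potential. *)
have led p q : A p -> A q -> le p q ->
    `|q - p| <= - (N + e + 1) * p.1 - - (N + e + 1) * q.1.
  move=> _ _ [pq1 pq2 _]; rewrite prod_norm_le/= ger0_norm ?subr_ge0//.
  have h : 0 <= q.1 - p.1 by rewrite subr_ge0.
  apply/andP; split; last by rewrite (le_trans pq2)//; nra.
  have : 0 <= (N + e) * (q.1 - p.1) by rewrite mulr_ge0// ltW.
  lra.
have lephi p : A p -> - (N + e + 1) * t <= - (N + e + 1) * p.1.
  by move=> [_ pt _ _]; rewrite !mulNr lerN2 ler_pM2l// ltr_wpDr.
have lecl p l : A p -> A l -> (forall eta, 0 < eta -> exists q,
    [/\ A q, le p q & `|q - l| <= eta]) -> le p l.
  move=> _ _ pl; split.
  - apply/ler_addgt0Pr => eta eta0; have [q [_ [pq _ _]]] := pl _ eta0.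
    rewrite prod_norm_le/= => /andP[+ _]; rewrite ler_distl => /andP[_ ?].
    by rewrite (le_trans pq).
  - apply/ler_addgt0Pr => eta eta0.
    have d0 : 0 < eta / (1 + (N + e)) by rewrite divr_gt0// ltr_wpDl.
    have [q [_ [_ pq _]]] := pl _ d0; rewrite prod_norm_le/= => /andP[q1 q2].
    have -> : l.2 - p.2 = (q.2 - p.2) - (q.2 - l.2).
      by rewrite opprB [RHS]addrC addrA subrK.
    rewrite (le_trans (ler_normB _ _))//.
    move: q1 q2; set d := eta / _ in d0 *.
    have : d * (1 + (N + e)) = eta by rewrite divfK// gt_eqF// ltr_wpDl.
    rewrite ler_distl => dE /andP[q1 q1'] q2.
    have : 0 <= (N + e) * (l.1 + d - q.1).
      by rewrite mulr_ge0 ?(ltW Ne0)// subr_ge0.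
    move: pq; nra.
  - move=> eta eta0.
    (* The errors in position, in [(q.1 - l.1) *: k] and in the elapsed time cost at most [d],
       [d * N] and [d * e], together [eta / 2]. *)
    have d0 : 0 < eta / 2 / (1 + N + e) by rewrite !divr_gt0// -addrA ltr_wpDl.
    have [q [_ [pq _ pqk]]] := pl _ d0; rewrite prod_norm_le/= => /andP[q1 q2].
    have eta20 : 0 < eta / 2 by rewrite divr_gt0.
    have [k Kk qk] := pqk _ eta20; exists k => //.
    have -> : l.2 - p.2 - (l.1 - p.1) *: k = (q.2 - p.2 - (q.1 - p.1) *: k) -
        (q.2 - l.2) + (q.1 - l.1) *: k.
      have -> : l.1 - p.1 = (q.1 - p.1) - (q.1 - l.1) by lra.
      have -> : l.2 - p.2 = (q.2 - p.2) - (q.2 - l.2).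
        by rewrite opprB [RHS]addrC addrA subrK.
      by rewrite [(_ - _) *: k]scalerBl [- (_ *: k - _)]opprB [X in _ + X]addrC
        addrACA addrA.
    move: q1 q2 qk; set d := eta / 2 / _ in d0 *.
    have : d * (1 + N + e) = eta / 2 by rewrite divfK// gt_eqF// -addrA
      ltr_wpDl.
    move=> dE q1 q2 qk.
    rewrite (le_trans (ler_normD _ _))// (le_trans (lerD (ler_normB _ _) (lexx
      _)))//.
    rewrite normrZ.
    have : `|q.1 - l.1| * `|k| <= d * N by rewrite ler_pM// KN.
    move: q1; rewrite ler_distl => /andP[q1 q1'].
    have : 0 <= e * (l.1 + d - q.1) by rewrite mulr_ge0 ?(ltW e0)// subr_ge0.
    move: qk q2 dE; nra.
have A0 : A (0, z0).
  by split => //=; [exact: ltW|rewrite subrr normr0 mulr0].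
have cRV : complete_space (R * V)%type.
  by apply: complete_space_prod => //; exact: complete_spaceR.
have [[s z] [[/= s0 st Cz sz] zle smax]] :=
  maximal_element cRV clA leA letr led lephi lecl A0.
suff ts : s = t.
  exists z; split => // eta eta0; case: zle => /= _ _ /(_ _ eta0)[k Kk].
  by rewrite ts subr0 => ?; exists k.
apply/eqP; apply: contrapT => /negP st'.
have {st'}st' : s < t by rewrite lt_neqAle st'.
have [|k [Kk /tangent_coneP zk]] := CK z Cz.
  rewrite (le_lt_trans sz)// (le_lt_trans _ tr)// mulrC ler_pM2r//.
have d0 : 0 < Num.min e (t - s) by rewrite lt_min e0 subr_gt0.
have [tau [z' [tau0 taut Cz' z'z]]] := zk _ d0.
move: taut; rewrite lt_min => /andP[taue taut].
have {}z'z : `|z' - z - tau *: k| <= e * tau.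
  by rewrite (le_trans z'z)// ler_pM2r// ge_min lexx.
have z'zN : `|z' - z| <= (N + e) * tau.
  have -> : z' - z = (z' - z - tau *: k) + tau *: k by rewrite subrK.
  rewrite (le_trans (ler_normD _ _))// normrZ gtr0_norm//.
  have : tau * `|k| <= tau * N by rewrite ler_pM2l// KN.
  move: z'z; lra.
have : (s + tau, z') = (s, z).
  apply: smax.
  - split => //=; [by rewrite addr_ge0// ltW|lra|].
    have -> : z' - z0 = (z' - z) + (z - z0) by rewrite addrA subrK.
    by rewrite (le_trans (ler_normD _ _))//; lra.
  - rewrite /le /= addrAC subrr add0r; split => //.
      by rewrite lerDl ltW.
    by move=> eta eta0; exists k => //; rewrite (le_trans z'z)// lerDl ltW.
by move=> [] /eqP; rewrite -subr_eq0 addrAC subrr add0r gt_eqF.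
Qed.

End trajectories.

(** Put [p = x - z.1]. Small steps along a tangent direction [(p, q)], with error rate |p| / 2,
    reduce the distance to [x] at rate at least |p| / 2, at speed at most (M + 3/2) |p|. The ratio
    [2 * M + 3] is the slope in the order, so a point with [z.1 != x] is never maximal. *)
Lemma exact_correction (R : realType) (X Y : normedModType R)
    (C : set (X * Y)) (x : X) (z0 : X * Y) (M : R) :
  complete_space (X * Y)%type -> closed C -> C z0 -> 0 <= M ->
  (forall z, C z -> `|z - z0| <= (2 * M + 3) * `|x - z0.1| -> z.1 != x ->
    exists2 q, `|q| <= M * `|x - z.1| & tangent_cone C z (x - z.1, q)) ->
  exists2 y, C (x, y) & `|y - z0.2| <= (2 * M + 3) * `|x - z0.1|.
Proof.
move=> cXY clC Cz0 M0 CK.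
set L := 2 * M + 3; have L0 : 0 < L by rewrite /L; lra.
pose phi (z : X * Y) := L * `|x - z.1|.
pose le (z z' : X * Y) := `|z' - z| <= phi z - phi z'.
have [|||||z [Cz z0z zmax]] := @maximal_element R _ C le phi 0 cXY clC _ _ _ _
  _ _ Cz0.
- by move=> z _; rewrite /le !subrr normr0.
- move=> z z' z'' _ _ _; rewrite /le => h1 h2.
  have -> : z'' - z = (z'' - z') + (z' - z) by rewrite addrA subrK.
  by rewrite (le_trans (ler_normD _ _))//; lra.
- by [].
- by move=> z _; rewrite mulr_ge0// ltW.
- move=> z l _ _ zl; rewrite /le; apply/ler_addgt0Pr => e e0.
  have d0 : 0 < e / (1 + L) by rewrite divr_gt0// addr_gt0.
  have [z' [_ zz' z'l]] := zl _ d0.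
  have dE : e / (1 + L) * (1 + L) = e by rewrite divfK// gt_eqF// addr_gt0.
  have -> : l - z = (z' - z) - (z' - l) by rewrite opprB [RHS]addrC addrA subrK.
  rewrite (le_trans (ler_normB _ _))//.
  have : `|x - l.1| <= `|x - z'.1| + `|z' - l|.
    have -> : x - l.1 = (x - z'.1) + (z' - l).1 by rewrite /= addrA subrK.
    rewrite (le_trans (ler_normD _ _))// lerD2l.
    by have := lexx `|z' - l|; rewrite {1}prod_norm_le => /andP[].
  move=> h; have : 0 <= L * (`|x - z'.1| + `|z' - l| - `|x - l.1|).
    by rewrite mulr_ge0 ?(ltW L0)// subr_ge0.
  move: zz' z'l; rewrite /le /phi; nra.
(* The order itself bounds the drift from [z0], which allows the tangency hypothesis to be used at
   [z]. *)
have z0zN : `|z - z0| <= L * `|x - z0.1|.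
  by rewrite (le_trans z0z)// gerDl oppr_le0 mulr_ge0// ltW.
have [zx|zx] := eqVneq z.1 x.
  exists z.2; first by rewrite -zx; case: (z) Cz.
  by move: z0zN; rewrite prod_norm_le => /andP[].
exfalso; have [q qM /tangent_coneP zq] := CK z Cz z0zN zx.
set p := x - z.1 in qM zq.
have p0 : 0 < `|p| by rewrite normr_gt0 subr_eq0 eq_sym.
have d0 : 0 < Num.min 1 (`|p| / 2) by rewrite lt_min ltr01 divr_gt0.
have [t [z' [t0]]] := zq _ d0; rewrite lt_min => /andP[t1 _] Cz' z'z.
have {}z'z : `|z' - z - t *: (p, q)| <= `|p| / 2 * t.
  by rewrite (le_trans z'z)// ler_pM2r// ge_min lexx orbT.
have xz' : `|x - z'.1| <= `|p| - `|p| / 2 * t.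
  have -> : x - z'.1 = (1 - t) *: p - (z' - z - t *: (p, q)).1.
    by rewrite /= scalerBl scale1r opprB addrA subrK opprB /p addrA subrK.
  move: z'z; rewrite prod_norm_le => /andP[z'z _].
  rewrite (le_trans (ler_normB _ _))// normrZ ger0_norm; last by lra.
  lra.
have z'zN : `|z' - z| <= (M + 1 + 1 / 2) * (t * `|p|).
  have -> : z' - z = (z' - z - t *: (p, q)) + t *: (p, q) by rewrite subrK.
  rewrite (le_trans (ler_normD _ _))// normrZ gtr0_norm//.
  have pqN : `|(p, q)| <= (M + 1) * `|p|.
    by rewrite prod_norm_le/=; apply/andP; split; nra.
  have : t * `|(p, q)| <= t * ((M + 1) * `|p|) by rewrite ler_pM2l.
  by move: z'z; lra.
have zz' : z' = z.
  apply: zmax => //; rewrite /le /phi -/p (le_trans z'zN)//.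
  have : L * `|x - z'.1| <= L * (`|p| - `|p| / 2 * t) by rewrite ler_pM2l.
  by rewrite /L; lra.
by move: xz'; rewrite zz' -/p; have := mulr_gt0 p0 t0; lra.
Qed.

(** * Finite-dimensional normed spaces *)

Lemma continuous_sum (R : realType) (T : topologicalType) (V : normedModType R)
    (I : Type) (s : seq I) (f : I -> T -> V) :
  (forall i, continuous (f i)) -> continuous (fun x => \sum_(i <- s) f i x).
Proof.
move=> cf; elim: s => [|i s IH] x.
  by under eq_fun do rewrite big_nil; exact: cst_continuous.
by under eq_fun do rewrite big_cons; apply: continuousD; [exact: cf|exact: IH].
Qed.

Section finite_dimension.
Context {R : realType} {V : normedModType R}.

Let comb n (e : 'I_n -> V) (c : 'rV[R]_n) : V := \sum_i c ord0 i *: e i.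

Let comb_continuous n (e : 'I_n -> V) : continuous (comb e).
Proof.
apply: continuous_sum => i c; apply: continuousZr_tmp.
exact: coord_continuous.
Qed.

Let combZ n (e : 'I_n -> V) a c : comb e (a *: c) = a *: comb e c.
Proof.
rewrite /comb scaler_sumr; apply: eq_bigr => i _.
by rewrite mxE scalerA.
Qed.

Let compact_rV_closed (n : nat) (A : set 'rV[R]_n) (r : R) :
  closed A -> (forall c, A c -> `|c| <= r) -> compact A.
Proof.
move=> clA Ar; apply: bounded_closed_compact => //.
exists r; split; first exact: num_real.
by move=> M /ltW rM c /Ar cr; exact: le_trans rM.
Qed.

(** On the compact unit sphere of coordinates the norm of [comb e c] attains its minimum, which is
    positive by injectivity; homogeneity does the rest. *)
Let comb_norm_ge n (e : 'I_n -> V) : (forall c, comb e c = 0 -> c = 0) ->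
  exists2 m, 0 < m & forall c, m * `|c| <= `|comb e c|.
Proof.
move=> inj; pose sphere := [set c : 'rV[R]_n | `|c| = 1].
have normalize (c : 'rV[R]_n) : c != 0 -> sphere (`|c|^-1 *: c).
  by move=> c0; rewrite /sphere/= normrZ normfV normr_id mulVf// normr_eq0.
have [[c0 Sc0]|noS] := pselect (sphere !=set0); last first.
  exists 1 => // c; have [->|/normalize c0] := eqVneq c 0.
    by rewrite normr0 mulr0.
  by exfalso; apply: noS; exists (`|c|^-1 *: c).
have cS : compact sphere.
  apply: (@compact_rV_closed _ _ 1) => [|c ->//].
  apply: (@closed_comp _ _ (Num.norm : 'rV[R]_n -> R) [set 1]).
    by move=> c _; exact: norm_continuous.
  exact: closed_eq.
have [||c /set_mem Sc cmin] :=
    @compact_EVT_min _ R (fun c => `|comb e c|) sphere _ cS.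
- by exists c0.
- apply: continuous_subspaceT => c; apply: (@continuous_comp _ _ _ (comb e)).
    exact: comb_continuous.
  exact: norm_continuous.
exists `|comb e c|.
  rewrite normr_gt0; apply/eqP => /inj cE.
  by move: Sc; rewrite /sphere/= cE normr0 => /esym/eqP; rewrite oner_eq0.
move=> d; have [->|d0] := eqVneq d 0; first by rewrite normr0 mulr0.
have := cmin _ (mem_set (normalize d d0)).
rewrite combZ normrZ normfV normr_id mulrC ler_pdivlMr// normr_gt0//.
Qed.

(** Induction on the number of generators. If they are independent, the ball is a closed subset of
    the image of a compact coordinate ball; otherwise a redundant generator is dropped. *)
Lemma finite_dimensional_compact_ball (r : R) : finite_dimensional V ->
  compact (closed_ball_ Num.norm (0 : V) r).
Proof.
move=> [n [e gen]].
elim: n e gen => [|n IH] e gen.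
  apply: (@subclosed_compact _ _ [set 0]); first exact: closed_closed_ball_.
    exact: compact_set1.
  by move=> v _; have [c ->] := gen v; rewrite big_ord0.
have [inj|] := pselect (forall c, comb e c = 0 -> c = 0).
  have [m m0 me] := comb_norm_ge inj.
  apply: (@subclosed_compact _ _
    (comb e @` closed_ball_ Num.norm (0 : 'rV[R]_n.+1) (r / m))).
  - exact: closed_closed_ball_.
  - apply: continuous_compact.
      by apply: continuous_subspaceT; exact: comb_continuous.
    apply: (@compact_rV_closed _ _ (r / m)); first exact: closed_closed_ball_.
    by move=> c; rewrite /closed_ball_/= sub0r normrN.
  - move=> v; rewrite /closed_ball_/= sub0r normrN => vr; have [c cE] := gen v.
    have vE : comb e (\row_i c i) = v.
      by rewrite cE; apply: eq_bigr => i _; rewrite mxE.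
    exists (\row_i c i) => //.
    by rewrite sub0r normrN ler_pdivlMr// mulrC (le_trans (me _))// vE.
move=> /existsNP[c /not_implyP[c0 /eqP/rV0Pn[i ci]]].
apply: (IH (fun j => e (lift i j))) => v; have [d dE] := gen v.
(* A multiple of the relation [c] is subtracted so that the coefficient of [e i] vanishes. *)
exists (fun j => d (lift i j) - d i / c ord0 i * c ord0 (lift i j)).
have -> : v = \sum_j (d j - d i / c ord0 i * c ord0 j) *: e j.
  under eq_bigr do rewrite scalerBl -scalerA; rewrite sumrB -scaler_sumr -dE.
  by rewrite -[\sum_(_ < _) _]/(comb e c) c0 scaler0 subr0.
by rewrite (bigD1_ord i)//= divfK// subrr scale0r add0r.
Qed.

Lemma finite_dimensional_complete : finite_dimensional V -> complete_space V.
Proof.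
move=> fdV F PF cF; have /cauchyP/(_ _ ltr01)[x Fx] := cF.
apply: (@compact_cauchy_cvg V (closed_ball_ Num.norm 0 (`|x| + 1)) F) => //;
  last exact: finite_dimensional_compact_ball.
apply: filterS Fx => y; rewrite -ball_normE /closed_ball_/= sub0r normrN => xy.
have -> : y = x - (x - y) by rewrite subKr.
by rewrite (le_trans (ler_normB _ _))// lerD2l ltW.
Qed.

End finite_dimension.

(** * Fattened maps and the outer norm *)

Section fattening.
Context {R : realType} {X Y : normedModType R}.
Implicit Types (H : X -> set Y) (w : X) (y : Y).

Lemma fattenP H (d : R) w y : 0 <= d ->
  fatten H d w y <-> exists2 h, H w h & `|y - h| <= d * `|w|.
Proof.
move=> d0; split=> [[h Hh [_ [b b1 <-] <-]]|[h Hh yh]].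
  exists h => //; rewrite addrAC subrr add0r normrZ ger0_norm ?mulr_ge0//.
  by rewrite ler_piMr ?mulr_ge0//; move: b1; rewrite /unit_ball /closed_ball_/=
    sub0r normrN.
exists h => //; exists (y - h); last by rewrite addrC subrK.
have [dw|dw] := eqVneq (d * `|w|) 0.
  exists 0; first by rewrite /unit_ball /closed_ball_/= subrr normr0.
  by rewrite scaler0; apply/esym/eqP; rewrite -normr_le0 (le_trans yh)// dw.
have {}dw : 0 < d * `|w| by rewrite lt_neqAle eq_sym dw mulr_ge0.
exists ((d * `|w|)^-1 *: (y - h)).
  rewrite /unit_ball /closed_ball_/= sub0r normrN normrZ normfV gtr0_norm//.
  by rewrite mulrC ler_pdivrMr// mul1r.
by rewrite scalerA divff ?gt_eqF// scale1r.
Qed.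

Lemma fattenZ H (d k : R) w y : pos_homogeneous H -> 0 <= d -> 0 < k ->
  fatten H d (k *: w) y -> fatten H d w (k^-1 *: y).
Proof.
move=> [_ homH] d0 k0 /(fattenP _ _ _ d0)[h + yh]; rewrite homH// => -[g Hg gh].
apply/(fattenP _ _ _ d0); exists g => //.
have -> : k^-1 *: y - g = k^-1 *: (y - h).
  by rewrite -gh scalerBr scalerA mulVf ?gt_eqF// scale1r.
rewrite normrZ normfV gtr0_norm// mulrC ler_pdivrMr// (le_trans yh)//.
by rewrite normrZ gtr0_norm// mulrCA mulrC.
Qed.

Lemma fatten_convex H (d : R) w : 0 <= d ->
  @convex_set R Y (H w) -> @convex_set R Y (fatten H d w).
Proof.
move=> d0 cH; apply: convex_setP => y y' a /(fattenP _ _ _ d0)[h Hh yh].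
move=> /(fattenP _ _ _ d0)[h' Hh' yh'] /andP[a0 a1].
apply/(fattenP _ _ _ d0).
have b0 : 0 <= 1 - a by rewrite subr_ge0.
have ab : a + (1 - a) = 1 by rewrite addrC subrK.
exists (a *: h + (1 - a) *: h').
  have := @convex_comb R Y (H w) h h' a (1 - a) cH Hh Hh' a0 b0.
  by rewrite ab !divr1; apply.
rewrite opprD addrACA -!scalerBr (le_trans (ler_normD _ _))// !normrZ.
by rewrite !ger0_norm//; nra.
Qed.

Lemma fatten_compact H (d : R) w : finite_dimensional Y ->
  compact (H w) -> compact (fatten H d w).
Proof.
move=> fdY cH.
have -> : fatten H d w = (fun z : Y * Y => z.1 + (d * `|w|) *: z.2) @`
    (H w `*` @unit_ball R Y).
  apply/seteqP; split => [_ [h Hh [_ [b Bb <-] <-]]|_ [[h b] [Hh Bb] <-]].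
    by exists (h, b).
  by exists h => //; exists ((d * `|w|) *: b) => //; exists b.
apply: continuous_compact.
  apply: continuous_subspaceT => z; apply: cvgD; first exact: cvg_fst.
  by apply: cvgZ; [exact: cvg_cst|exact: cvg_snd].
by apply: compact_setX => //; exact: finite_dimensional_compact_ball.
Qed.

(** Homogeneity carries the bound from the unit ball to all [w != 0]; the set [H 0] is bounded and
    stable under positive scaling, hence contains only the zero vector. *)
Lemma outer_norm_bound H : pos_homogeneous H -> (outer_norm H < +oo)%E ->
  exists2 M, 0 <= M & forall w z, H w z -> `|z| <= M * `|w|.
Proof.
move=> [H00 homH] Hfin.
have [M M0 HM] : exists2 M : R, 0 <= M & (outer_norm H <= M%:E)%E.
  move: Hfin; case: (outer_norm H) => [m _|//|_]; last by exists 0;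
    rewrite ?leNye.
  by exists (Num.max 0 m); rewrite ?lee_fin le_max lexx ?orbT.
have bnd w z : `|w| <= 1 -> H w z -> `|z| <= M.
  move=> w1 Hz; rewrite -lee_fin (le_trans _ HM)//.
  apply: (@le_trans _ _ (ereal_sup [set `|z|%:E | z in H w])).
    by apply: ereal_sup_ubound; exists z.
  apply: ereal_sup_ubound; exists w => //.
  by rewrite /unit_ball /closed_ball_/= sub0r normrN.
exists M => // w z Hz; have [w0|w0] := eqVneq w 0; last first.
  have w0' : 0 < `|w| by rewrite normr_gt0.
  have := bnd (`|w|^-1 *: w) (`|w|^-1 *: z).
  rewrite !normrZ !normfV !normr_id mulVf ?normr_eq0// => /(_ (lexx _)).
  rewrite mulrC ler_pdivrMr// => -> //.
  by rewrite homH ?invr_gt0//; exists z.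
rewrite w0 normr0 mulr0; apply/ler_addgt0Pr => e e0; rewrite add0r.
(* Scaled by this factor, [z] stays in [H 0] and so has norm at most [M], which forces |z| <= e. *)
have k0 : 0 < (M + 1) / e by rewrite divr_gt0// ltr_wpDl.
have := bnd 0 (((M + 1) / e) *: z).
rewrite normr0 ler01 normrZ gtr0_norm// => /(_ isT) h.
have {}h : (M + 1) / e * `|z| <= M.
  by apply: h; rewrite -(scaler0 _ ((M + 1) / e)) homH//; exists z => //;
    rewrite -w0.
have : (M + 1) * `|z| <= M * e by rewrite -ler_pdivrMr// mulrAC.
nra.
Qed.

End fattening.

(** * Pseudo strict differentiability and the graphical derivative *)

Lemma nbhs_closed_ball_ (R : realType) (V : normedModType R) (z0 z : V) (e : R)
  :
  `|z - z0| < e -> nbhs z (closed_ball_ Num.norm z0 e).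
Proof.
move=> ze; apply/nbhs_ballP; exists (e - `|z - z0|);
  first by rewrite /= subr_gt0.
move=> y; rewrite -ball_normE /ball_ /closed_ball_/= => zy.
have -> : z0 - y = (z - y) - (z - z0) by rewrite opprB [RHS]addrC addrA subrK.
by rewrite (le_trans (ler_normB _ _))//; lra.
Qed.

Section criteria.
Context {R : realType} {X Y : normedModType R}.
Implicit Types S H : X -> set Y.

(** The set [K] of the overview: it meets the tangent cone to [gph S] at a point exactly when the
    intersection in (2) is nonempty there. *)
Definition opp_direction_set H (d : R) (p : X) : set (X * Y) :=
  [set (p, - z) | z in fatten H d (- p)].

Lemma opp_direction_set_convex H (d : R) p : 0 <= d -> convex_valued H ->
  @convex_set R (X * Y)%type (opp_direction_set H d p).
Proof.
move=> d0 cH; apply: convex_setP => _ _ a [y Hy <-] [y' Hy' <-] /andP[a0 a1].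
have b0 : 0 <= 1 - a by rewrite subr_ge0.
have ab : a + (1 - a) = 1 by rewrite addrC subrK.
exists (a *: y + (1 - a) *: y').
  have := @convex_comb R Y _ y y' a (1 - a) (fatten_convex d0 (cH (- p))) Hy
    Hy' a0 b0.
  by rewrite ab !divr1; apply.
congr pair; first by rewrite -scalerDl ab scale1r.
by rewrite /= !scalerN opprD.
Qed.

Lemma opp_direction_set_compact H (d : R) p : finite_dimensional Y ->
  compact_valued H -> compact (opp_direction_set H d p).
Proof.
move=> fdY cH; apply: continuous_compact.
  apply: continuous_subspaceT => z; apply: cvg_pair; first exact: cvg_cst.
  by apply: cvgN; exact: cvg_id.
exact: fatten_compact.
Qed.

(** The summand 1 accounts for the component [p] in the max norm. *)
Lemma opp_direction_set_bound H (d M : R) p k : 0 <= d -> 0 <= M ->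
  (forall w z, H w z -> `|z| <= M * `|w|) ->
  opp_direction_set H d p k -> `|k| <= (1 + M + d) * `|p|.
Proof.
move=> d0 M0 HM [z /(fattenP _ _ _ d0)[h /HM hM zh] <-].
rewrite normrN in zh hM; rewrite prod_norm_le/= normrN.
have p0 := normr_ge0 p.
apply/andP; split; first nra.
rewrite -[z](subrK h) (le_trans (ler_normD _ _))//; nra.
Qed.

(** The derivative [D] is arbitrary so as to serve (2) and (2') alike; [r <= e] keeps the ball where
    the criterion holds inside the one where the graph is closed. *)
Lemma derivative_criterion_nbhs D S H xbar ybar (d : R) :
  locally_closed S xbar ybar -> derivative_criterion D S H xbar ybar -> 0 < d ->
  exists e r, [/\ 0 < r, r <= e,
    closed (gph S `&` closed_ball_ Num.norm (xbar, ybar) e) &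
    forall z p, gph S z -> `|z - (xbar, ybar)| < r -> p != 0 ->
      exists2 q, D z.1 z.2 p q & opp_direction_set H d p (p, q)].
Proof.
move=> [e e0 clS] crit d0; have [U [V [Ux Vy UV]]] := crit d d0.
move/nbhs_ballP: Ux => [r1 /= r10 Ux]; move/nbhs_ballP: Vy => [r2 /= r20 Vy].
exists e, (Num.min e (Num.min r1 r2)); split => //.
- by rewrite !lt_min e0 r10.
- by rewrite ge_min lexx.
move=> [x y] p Sxy; rewrite prod_norm_lt !lt_min/= => zr p0.
move: zr => /andP[/and3P[_ xr1 _] /and3P[_ _ yr2]].
have [|q [Dq [z Hz zq]]] := UV x y p _ p0.
  split=> //; split => /=.
    by apply: Ux; rewrite -ball_normE /ball_/= distrC.
  by apply: Vy; rewrite -ball_normE /ball_/= distrC.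
by exists q => //; exists z => //; rewrite zq.
Qed.

(** Applying (1) to [x] and [x + t *: p] and dividing by [t] gives an exact difference quotient of
    the graph lying in the compact set of directions. *)
Lemma pseudo_strict_diff_criterion S H xbar ybar : pos_homogeneous H ->
  finite_dimensional Y -> compact_valued H ->
  pseudo_strictly_differentiable S H xbar ybar ->
  derivative_criterion (graphical_derivative S) S H xbar ybar.
Proof.
move=> homH fdY cH psd d d0; have [U [V [Ux Vy UV]]] := psd d d0.
exists (interior U), V; split => //; first exact: nbhs_interior.
move=> x y p [Sxy [/= Uox Vyy]] p0.
have [||[_ _] [[z Hz [<- <-]] tz]] :=
    @compact_meets_tangent_cone R _ (gph S) (opp_direction_set H d p) (x, y).
- exact: opp_direction_set_compact.
- move=> e e0; move/nbhs_ballP: (Uox) => [r /= r0 xU].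
  pose t := Num.min (e / 2) (r / 2 / `|p|).
  have pn0 : 0 < `|p| by rewrite normr_gt0.
  have t0 : 0 < t by rewrite lt_min !divr_gt0.
  have te : t < e.
    by rewrite (@le_lt_trans _ _ (e / 2))// ?ge_min ?lexx//; lra.
  have tr : t * `|p| < r.
    rewrite (@le_lt_trans _ _ (r / 2))//; last by lra.
    by rewrite -ler_pdivlMr// ge_min lexx orbT.
  have Uxp : U (x + t *: p).
    by apply: xU; rewrite -ball_normE /ball_/= opprD addrA subrr sub0r normrN
      normrZ gtr0_norm.
  have [y' Sy' [w]] := UV x (x + t *: p) (nbhs_singleton Uox) Uxp y (conj Sxy
    Vyy).
  rewrite opprD addrA subrr sub0r -scalerN => /(fattenZ homH (ltW d0) t0) Hw yE.
  exists t, (x + t *: p, y'), (p, - (t^-1 *: w)); split => //.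
  + by rewrite t0.
  + by exists (t^-1 *: w).
  rewrite (_ : _ - _ - _ = 0) ?normr0 ?mulr_ge0 ?ltW//.
  congr pair => /=; first by rewrite addrAC addrK subrr.
  by rewrite scalerN scalerA divff ?gt_eqF// scale1r -yE opprD addrA subrr
    sub0r opprK addNr.
exists (- z); split => //; by exists z.
Qed.

(** From [(x, y)] one moves along [p = x' - x] for unit time, then corrects the abscissa to exactly
    [x']. The errors are [d * |p|] from the fattening, [eps] from the motion and [L * eps] from the
    correction; they add up to [d0 * |p|]. *)
Lemma criterion_pseudo_strict_diff S H xbar ybar :
  locally_closed S xbar ybar -> pos_homogeneous H ->
  (outer_norm H < +oo)%E -> convex_valued H ->
  complete_space X -> complete_space Y ->
  derivative_criterion (graphical_derivative S) S H xbar ybar ->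
  pseudo_strictly_differentiable S H xbar ybar.
Proof.
move=> clS homH finH cvH cX cY crit d0 d00.
have cXY := complete_space_prod cX cY.
have [M M0 HM] := outer_norm_bound homH finH.
pose d := d0 / 2; have dgt0 : 0 < d by rewrite divr_gt0.
have [e [r [r0 re clC critr]]] := derivative_criterion_nbhs clS crit dgt0.
set C := _ `&` _ in clC.
have tC z w : `|z - (xbar, ybar)| < r -> tangent_cone (gph S) z w ->
    tangent_cone C z w.
  move=> zr; rewrite tangent_coneI_nbhs//; apply: nbhs_closed_ball_.
  exact: lt_le_trans re.
(* The directions are bounded by [Q * |p|], and [L] is the cost factor of [exact_correction] with
   [Q] as its constant. *)
pose Q := 1 + M + d; pose L := 2 * Q + 3.
have Q1 : 1 <= Q by rewrite /Q; lra.
have L0 : 0 < L by rewrite /L; lra.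
(* With this radius the motion stays within [r / 2] of [(x, y)] and the correction never leaves the
   ball of radius [r] where the criterion is available. *)
pose rho := r / (4 * (L + 3)).
have rho0 : 0 < rho by rewrite divr_gt0// mulr_gt0//; lra.
have rhoE : rho * (4 * (L + 3)) = r.
  by rewrite /rho divfK// gt_eqF// mulr_gt0//; lra.
exists (ball xbar rho), (ball ybar rho); split; [exact: nbhsx_ballx|exact:
  nbhsx_ballx|].
move=> x x'; rewrite -!ball_normE /ball_/= => xr x'r y [Sy yr].
pose p := x' - x.
have [xx'|p0] := eqVneq x' x.
  exists y; first by rewrite xx'.
  exists 0; last by rewrite addr0.
  apply/(fattenP _ _ _ (ltW d00)); exists 0; rewrite ?subr0 ?normr0 ?mulr_ge0
    ?(ltW d00)//.
  by rewrite xx' subrr; case: homH.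
have {p0}p0 : p != 0 by rewrite subr_eq0.
have pn0 : 0 < `|p| by rewrite normr_gt0.
have prho : `|p| < 2 * rho.
  have -> : p = (xbar - x) - (xbar - x') by rewrite opprB [RHS]addrC addrA
    subrK.
  by rewrite (le_lt_trans (ler_normB _ _))//; lra.
have Qp : Q * `|p| <= 2 * (Q * rho).
  by rewrite mulrCA ler_wpM2l// ?ltW// (lt_le_trans ltr01).
have Qrho : 0 <= Q * rho by rewrite mulr_ge0 ?ltW// (lt_le_trans ltr01).
have rE : r = 8 * (Q * rho) + 24 * rho by rewrite -rhoE /L; lra.
have dp : d * `|p| <= Q * `|p| by rewrite ler_wpM2r// /Q; lra.
pose eps := d * `|p| / (1 + L).
have eps0 : 0 < eps by rewrite divr_gt0 ?mulr_gt0// addr_gt0.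
have epsE : eps * (1 + L) = d * `|p| by rewrite /eps divfK// gt_eqF// addr_gt0.
have epsp : eps <= `|p|.
  have dL : d <= 1 + L by rewrite /L /Q; lra.
  rewrite -(ler_pM2r (addr_gt0 ltr01 L0)) epsE; nra.
have z0r : `|(x, y) - (xbar, ybar)| < rho.
  by rewrite prod_norm_lt/= distrC xr distrC yr.
have Cz0 : C (x, y).
  split=> //; rewrite /closed_ball_/= distrC (le_trans (ltW z0r))//.
  by rewrite (le_trans _ re)// rE; lra.
have [|||z [_ [[Sz _] [w Hw <-] zw]]] := @approximate_trajectory R _ C
  (opp_direction_set H d p) (x, y) (Q * `|p|) (r / 2) eps 1 cXY clC
  (opp_direction_set_convex (ltW dgt0) cvH)
  (fun k => @opp_direction_set_bound H d M p k (ltW dgt0) M0 HM) _ eps0 _ Cz0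
    ltr01.
- by rewrite mulr_ge0// ltW// (lt_le_trans ltr01).
- move=> z [Sz _] zr.
  have zr' : `|z - (xbar, ybar)| < r.
    have -> : z - (xbar, ybar) = (z - (x, y)) + ((x, y) - (xbar, ybar)).
      by rewrite addrA subrK.
    by rewrite (le_lt_trans (ler_normD _ _))//; lra.
  have [q Dq Hq] := critr z p Sz zr' p0.
  by exists (p, q); split => //; apply: tC => //; case: (z) Dq.
- by rewrite mul1r; lra.
move: zw; rewrite scale1r mulr1 => zw.
have zx' : `|x' - z.1| <= eps.
  move: zw; rewrite prod_norm_le/= => /andP[+ _].
  by rewrite /p opprB addrA subrK distrC.
have zw2 : `|z.2 - y + w| <= eps.
  by move: zw; rewrite prod_norm_le/= opprK => /andP[].
have zz0 : `|z - (x, y)| <= Q * `|p| + eps.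
  have -> : z - (x, y) = (z - (x, y) - (p, - w)) + (p, - w) by rewrite subrK.
  rewrite (le_trans (ler_normD _ _))// addrC lerD//.
  by apply: (@opp_direction_set_bound H d M) => //; [exact: ltW|exists w].
have zbar : `|z - (xbar, ybar)| <= Q * `|p| + eps + rho.
  have -> : z - (xbar, ybar) = (z - (x, y)) + ((x, y) - (xbar, ybar)).
    by rewrite addrA subrK.
  by rewrite (le_trans (ler_normD _ _))// lerD// ltW.
have Leps : L * eps <= d * `|p| by rewrite -epsE; nra.
have Cz : C z.
  split=> //; rewrite /closed_ball_/= distrC (le_trans zbar)// (le_trans _
    re)//.
  by lra.
have [||y' [Sy' _]] := @exact_correction R X Y C x' z Q cXY clC Cz.
- by rewrite (le_trans _ Q1).
- move=> z1 [Sz1 _] z1z z1x'.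
  have z1r : `|z1 - (xbar, ybar)| < r.
    have -> : z1 - (xbar, ybar) = (z1 - z) + (z - (xbar, ybar)).
      by rewrite addrA subrK.
    rewrite (le_lt_trans (ler_normD _ _))//.
    have : (2 * Q + 3) * `|x' - z.1| <= L * eps by rewrite ler_pM2l.
    by move: z1z zbar; lra.
  have p1 : x' - z1.1 != 0 by rewrite subr_eq0 eq_sym.
  have [q Dq Hq] := critr z1 (x' - z1.1) Sz1 z1r p1.
  exists q; last by apply: tC => //; case: (z1) Dq.
  have := opp_direction_set_bound (ltW dgt0) M0 HM Hq.
  by rewrite prod_norm_le/= => /andP[].
move=> y'z; exists y' => //; exists (y - y'); last by rewrite addrC subrK.
apply/(fattenP _ _ _ (ltW d00)).
have /(fattenP _ _ _ (ltW dgt0))[h Hh wh] := Hw.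
rewrite opprB in Hh wh; exists h => //.
(* The three terms are the errors of fattening, motion and correction, in this order. *)
have -> : y - y' - h = (w - h) - (z.2 - y + w) - (y' - z.2).
  rewrite opprD [w - h]addrC [- (z.2 - y) - w]addrC addrA addrK !opprB.
  by rewrite -[RHS]addrA [y - z.2 + _]addrA subrK [RHS]addrC.
have y'zeps : `|y' - z.2| <= L * eps.
  by rewrite (le_trans y'z)// ler_pM2l.
rewrite (le_trans (ler_normB _ _))// (le_trans (lerD (ler_normB _ _) (lexx
  _)))//.
have d0E : d0 = 2 * d by rewrite /d; lra.
have pE : `|x - x'| = `|p| by rewrite distrC.
by rewrite pE in wh *; rewrite d0E; lra.
Qed.

End criteria.

(** * Inner products and nearest points *)

Lemma cvg_sqr (R : realType) (T : Type) (F : set_system T) (FF : Filter F)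
    (f : T -> R) (a : R) :
  f @ F --> a -> (fun x => f x ^+ 2) @ F --> a ^+ 2.
Proof.
by move=> fa; under eq_fun do rewrite expr2; rewrite expr2; exact: cvgM.
Qed.

Section inner_product.
Context {R : realType} {V : normedModType R}.

(** The norm of [X * Y] is the max norm, so the inner product used for projections is only asked to
    be equivalent to it, up to the factor [B]. *)
Record norm_equivalent_inner_product (B : R) (ip : V -> V -> R) : Prop := {
  ipC : forall v w, ip v w = ip w v;
  ipDl : forall u v w, ip (u + v) w = ip u w + ip v w;
  ipZl : forall a v w, ip (a *: v) w = a * ip v w;
  ip_continuous : forall w, continuous (ip w);
  ip_diag_continuous : continuous (fun v => ip v v);
  ip_norm_ge : forall v, `|v| ^+ 2 <= ip v v;
  ip_norm_le : forall v, ip v v <= B * `|v| ^+ 2 }.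

Context (B : R) (ip : V -> V -> R)
  (ipP : norm_equivalent_inner_product B ip).

Let ipDr u v w : ip w (u + v) = ip w u + ip w v.
Proof. by rewrite !(ipC ipP w) (ipDl ipP). Qed.

Let ipZr a v w : ip w (a *: v) = a * ip w v.
Proof. by rewrite !(ipC ipP w) (ipZl ipP). Qed.

Let ip_sqrD v w : ip (v + w) (v + w) = ip v v + 2 * ip v w + ip w w.
Proof. by rewrite (ipDl ipP) !ipDr (ipC ipP w v); lra. Qed.

(** Expanding the square at [u n = c + g] gives [2 * ip w g <= ip g g], of second order in the step;
    so tangent vectors lie in the half-space [ip w v <= 0]. It is closed and convex, hence contains
    the closed convex hull. *)
Lemma nearest_point_normal (C : set V) (x c q : V) :
  (forall c', C c' -> ip (x - c) (x - c) <= ip (x - c') (x - c')) ->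
  closure (convex_hull (tangent_cone C c)) q -> ip (x - c) q <= 0.
Proof.
move=> cmin; set w := x - c in cmin *.
pose P := [set v | ip w v <= 0].
have clP : closed P.
  apply: (@closed_comp _ _ (ip w) [set s | s <= 0]); last exact: closed_le.
  by move=> v _; exact: (ip_continuous ipP).
have cvP : @convex_set R V P.
  apply: convex_setP => v v' a; rewrite /P/= => Pv Pv' /andP[a0 a1].
  have b0 : 0 <= 1 - a by rewrite subr_ge0.
  by rewrite ipDr !ipZr; nra.
suff tP : tangent_cone C c `<=` P.
  by move=> /(closure_subset (smallest_sub cvP tP)) /clP.
move=> v [u [t [Cu uc t0 tc uv]]].
have lim1 : (fun n => 2 * ip w ((t n)^-1 *: (u n - c))) @ \oo --> 2 * ip w v.
  by apply: cvgM; [exact: cvg_cst|apply: continuous_cvg => //;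
    exact: (ip_continuous ipP)].
(* The quadratic term divided by [t n] still carries a factor [t n] and vanishes in the limit. *)
have lim2 : (fun n => B * (t n * `|(t n)^-1 *: (u n - c)| ^+ 2)) @ \oo -->
    B * (0 * `|v| ^+ 2).
  apply: cvgM; first exact: cvg_cst.
  by apply: cvgM => //; apply: cvg_sqr; exact: cvg_norm.
have : 2 * ip w v <= B * (0 * `|v| ^+ 2).
  apply: (ler_cvg_to lim1 lim2); near=> n.
  have := cmin _ (Cu n); set g := u n - c.
  have -> : x - u n = w + (-1) *: g.
    by rewrite scaleN1r /w /g opprB addrA subrK.
  rewrite ip_sqrD ipZr (ipZl ipP) ipZr => h.
  have := ip_norm_le ipP g; rewrite ipZr normrZ normfV gtr0_norm// => gB.
  have -> : B * (t n * ((t n)^-1 * `|g|) ^+ 2) = (t n)^-1 * (B * `|g| ^+ 2).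
    by field; rewrite gt_eqF.
  by rewrite mulrCA ler_pM2l ?invr_gt0//; lra.
by rewrite /P/= mul0r mulr0; lra.
Unshelve. all: by end_near. Qed.

Lemma nearest_point_exists (C : set V) (x : V) : compact C -> C !=set0 ->
  exists2 c, C c & forall c', C c' -> ip (x - c) (x - c) <= ip (x - c') (x -
    c').
Proof.
move=> cC C0.
have [|c /set_mem Cc cmin] :=
    @compact_EVT_min _ R (fun c => ip (x - c) (x - c)) C C0 cC.
  apply: continuous_subspaceT => c.
  apply: (@continuous_comp _ _ _ (fun c => x - c) (fun v => ip v v)).
    by apply: cvgB; [exact: cvg_cst|exact: cvg_id].
  exact: (ip_diag_continuous ipP).
by exists c => // c' Cc'; apply: cmin; exact: mem_set.
Qed.

(** Steps [h *: q] alternate with projections onto [C]. Since [ip (x - c) q <= 0], each step adds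
    only its own square to the squared distance. Convexity averages the steps taken into one
    direction of [K]. *)
Lemma proximal_trajectory (C K : set V) (z0 : V) (N r e t : R) :
  compact C -> @convex_set R V K -> (forall k, K k -> `|k| <= N) ->
  0 <= N -> 1 <= B -> 0 < e -> 0 < t -> t * N * (B + 1) <= r -> C z0 ->
  (forall z, C z -> `|z - z0| <= r ->
    K `&` closure (convex_hull (tangent_cone C z)) !=set0) ->
  exists z k, [/\ C z, K k & `|z - z0 - t *: k| <= e * t].
Proof.
move=> cC cK KN N0 B1 e0 t0 tr Cz0 CK.
have B0 : 0 <= B by rewrite (le_trans ler01).
have tN0 : 0 <= t * N by rewrite mulr_ge0// ltW.
have [k0 [Kk0 _]] : K `&` closure (convex_hull (tangent_cone C z0)) !=set0.
  apply: CK => //; rewrite subrr normr0 (le_trans _ tr)// mulr_ge0//.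
  by rewrite addr_ge0.
(* After [n.+1] steps of length [t / n.+1] the squared error is at most
   [t ^+ 2 * B * N ^+ 2 / n.+1], which has to be at most [(e * t) ^+ 2]. *)
have [n nP] : exists n : nat, B * N ^+ 2 <= n.+1%:R * e ^+ 2.
  exists (Num.truncn (B * N ^+ 2 / e ^+ 2)).
  by rewrite -ler_pdivrMr ?exprn_gt0// ltW// truncnS_gt.
pose h := t / n.+1%:R.
have n0 : 0 < n.+1%:R :> R by rewrite ltr0n.
have h0 : 0 < h by rewrite divr_gt0.
have hn : n.+1%:R * h = t by rewrite /h mulrC divfK// gt_eqF.
have ipK k : K k -> ip k k <= B * N ^+ 2.
  move=> Kk; rewrite (le_trans (ip_norm_le ipP _))// ler_wpM2l//.
  by rewrite lerXn2r ?nnegrE// KN.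
have steps (j : nat) : (j <= n.+1)%N -> exists k c, [/\ K k, C c &
    ip (z0 + (j%:R * h) *: k - c) (z0 + (j%:R * h) *: k - c) <=
    j%:R * h ^+ 2 * (B * N ^+ 2)].
  elim: j => [_|j IH jn].
    exists k0, z0; split => //; rewrite !mul0r scale0r addr0 subrr.
    by rewrite -(scale0r (0 : V)) (ipZl ipP) mul0r.
  have [k [c1 [Kk Cc1 kc1]]] := IH (ltnW jn).
  set x := z0 + _ in kc1.
  have [|c Cc cmin] := @nearest_point_exists C x cC; first by exists z0.
  have xc := le_trans (cmin _ Cc1) kc1.
  have jh : j%:R * h <= t.
    by rewrite -hn ler_pM2r// ler_nat ltnW.
  have jh0 : 0 <= j%:R * h by rewrite mulr_ge0// ltW.
  (* With the motion bound [t * N], this keeps the projection within [t * N * (B + 1) <= r] of [z0],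
     where the next direction is available. *)
  have xcN : `|x - c| <= t * N * B.
    have hle : h <= t.
      by rewrite -hn ler_peMl ?(ltW h0)// ler1n.
    have tNB0 : 0 <= t * N * B by rewrite mulr_ge0.
    rewrite -(@ler_pXn2r _ 2) ?nnegrE//.
    rewrite (le_trans (ip_norm_ge ipP _))// (le_trans xc)//.
    have -> : j%:R * h ^+ 2 * (B * N ^+ 2) = (j%:R * h) * h * (B * N ^+ 2).
      by ring.
    have -> : (t * N * B) ^+ 2 = t * t * (B * N ^+ 2) * B by ring.
    have BN0 : 0 <= B * N ^+ 2 by rewrite mulr_ge0// sqr_ge0.
    apply: (@le_trans _ _ (t * t * (B * N ^+ 2))).
      by rewrite ler_wpM2r// ler_pM// ltW.
    by rewrite ler_peMr// !mulr_ge0// ltW.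
  have [|q [Kq /(nearest_point_normal cmin) q0]] := CK c Cc.
    have -> : c - z0 = (j%:R * h) *: k - (x - c).
      rewrite /x opprB addrA [_ + c]addrC -addrA; congr (_ + _).
      by rewrite opprD addrC subrK.
    rewrite (le_trans (ler_normB _ _))// normrZ ger0_norm//.
    have : j%:R * h * `|k| <= t * N by rewrite ler_pM// KN.
    by move: xcN tr; lra.
  have j1 : 0 < j%:R + 1 :> R by rewrite ltr_wpDl// ler0n.
  (* The weights make [(j + 1) * h] times the new direction equal to [(j * h) *: k + h *: q]. *)
  exists ((j%:R / (j%:R + 1)) *: k + (1 / (j%:R + 1)) *: q), c; split => //.
    by apply: convex_comb => //; exact: ler01.
  have -> : z0 + (j.+1%:R * h) *: ((j%:R / (j%:R + 1)) *: k +
      (1 / (j%:R + 1)) *: q) - c = (x - c) + h *: q.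
    rewrite -natr1 scalerDr !scalerA.
    have -> : (j%:R + 1) * h * (j%:R / (j%:R + 1)) = j%:R * h.
      by field; rewrite gt_eqF.
    have -> : (j%:R + 1) * h * (1 / (j%:R + 1)) = h.
      by field; rewrite gt_eqF.
    by rewrite addrA -/x addrAC.
  rewrite ip_sqrD !ipZr (ipZl ipP) -natr1.
  have : h * (h * ip q q) <= h * (h * (B * N ^+ 2)) by rewrite !ler_pM2l// ipK.
  have : h * ip (x - c) q <= 0 by rewrite pmulr_rle0.
  by move: xc; lra.
have [k [c [Kk Cc]]] := steps _ (leqnn _).
rewrite hn => kc; exists c, k; split => //.
have et0 : 0 <= e * t by rewrite ltW// mulr_gt0.
rewrite -(@ler_pXn2r _ 2) ?nnegrE//.
have -> : c - z0 - t *: k = - (z0 + t *: k - c) by rewrite opprB opprD addrA.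
rewrite normrN (le_trans (ip_norm_ge ipP _))// (le_trans kc)//.
have -> : n.+1%:R * h ^+ 2 * (B * N ^+ 2) = (h * t) * (B * N ^+ 2).
  by rewrite -hn; ring.
rewrite (le_trans (ler_wpM2l _ nP)) ?mulr_ge0 ?(ltW h0) ?(ltW t0)//.
have -> : h * t * (n.+1%:R * e ^+ 2) = (n.+1%:R * h) * t * e ^+ 2 by ring.
by rewrite hn exprMn; lra.
Qed.

End inner_product.

(** Continuity of [dot w] comes from that of the norm by polarization. *)
Lemma euclidean_inner_product (R : realType) (V : normedModType R) :
  euclidean V -> exists ip : V -> V -> R,
    norm_equivalent_inner_product 1 ip /\ forall v, ip v v = `|v| ^+ 2.
Proof.
move=> [_ [dot dotE]]; exists dot.
have dotC v w : dot v w = dot w v.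
  by rewrite hermitian_subproof expr0 mul1r.
have dotD u v w : dot (u + v) w = dot u w + dot v w.
  by rewrite -[u]scale1r linearPl mul1r scale1r.
have dot0 w : dot 0 w = 0.
  by apply: (addIr (dot 0 w)); rewrite -dotD !add0r.
have dotZ a v w : dot (a *: v) w = a * dot v w.
  have : dot (a *: v + 0) w = a * dot v w + dot 0 w by rewrite linearPl.
  by rewrite addr0 dot0 addr0.
have norm2c : continuous (fun v : V => `|v| ^+ 2 : R).
  by move=> v; apply: cvg_sqr; apply: cvg_norm; exact: cvg_id.
split; last by move=> v; rewrite dotE.
split => //.
- move=> w.
  have -> : dot w = fun q => (`|w + q| ^+ 2 - `|w| ^+ 2 - `|q| ^+ 2) / 2.
    apply/funext => q; rewrite !dotE dotD !(dotC _ (w + q)) !dotD (dotC q w).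
    by field.
  move=> q; apply: cvgM; last exact: cvg_cst.
  apply: cvgB; last exact: norm2c.
  apply: cvgB; last exact: cvg_cst.
  apply: cvg_sqr; apply: cvg_norm; apply: cvgD; [exact: cvg_cst|exact: cvg_id].
- by under eq_fun do rewrite -dotE.
- by move=> v; rewrite dotE.
- by move=> v; rewrite dotE mul1r.
Qed.

(** The two inner products are added: the sum of two squares lies between the larger square and
    twice it, whence the factor 2. *)
Lemma prod_inner_product (R : realType) (X Y : normedModType R) :
  euclidean X -> euclidean Y -> exists ip : X * Y -> X * Y -> R,
    norm_equivalent_inner_product 2 ip.
Proof.
move=> /euclidean_inner_product[ipX [PX XE]] /euclidean_inner_product[ipY [PY
  YE]].
exists (fun v w => ipX v.1 w.1 + ipY v.2 w.2); split.
- by move=> v w; rewrite (ipC PX) (ipC PY).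
- by move=> u v w; rewrite /= (ipDl PX) (ipDl PY) addrACA.
- by move=> a v w; rewrite /= (ipZl PX) (ipZl PY) mulrDr.
- move=> w v; apply: cvgD.
    by apply: continuous_cvg; [exact: (ip_continuous PX)|exact: cvg_fst].
  by apply: continuous_cvg; [exact: (ip_continuous PY)|exact: cvg_snd].
- move=> v; apply: cvgD.
    by apply: (continuous_cvg _ (@ip_diag_continuous _ _ _ _ PX _));
      exact: cvg_fst.
  by apply: (continuous_cvg _ (@ip_diag_continuous _ _ _ _ PY _));
    exact: cvg_snd.
- move=> v; rewrite XE YE.
  have [h|h] := leP `|v.1| `|v.2|.
    have : `|v| <= `|v.2| by rewrite prod_norm_le h lexx.
    have := normr_ge0 v; nra.
  have : `|v| <= `|v.1| by rewrite prod_norm_le lexx ltW.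
  have := normr_ge0 v; nra.
- move=> v; rewrite XE YE.
  have := lexx `|v|; rewrite {1}prod_norm_le => /andP[h1 h2].
  have := normr_ge0 v.1; have := normr_ge0 v.2; nra.
Qed.

Lemma finite_dimensional_prod_compact_ball (R : realType)
    (X Y : normedModType R) (z : X * Y) (r : R) :
  finite_dimensional X -> finite_dimensional Y ->
  compact (closed_ball_ Num.norm z r).
Proof.
move=> fdX fdY.
apply: (@subclosed_compact _ _
  (closed_ball_ Num.norm 0 (`|z| + r) `*` closed_ball_ Num.norm 0 (`|z| + r))).
- exact: closed_closed_ball_.
- by apply: compact_setX; exact: finite_dimensional_compact_ball.
move=> v; rewrite /closed_ball_/= => zv.
have : `|v| <= `|z| + r.
  by rewrite -[v](subKr z) (le_trans (ler_normB _ _))// lerD2l.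
by rewrite prod_norm_le => /andP[v1 v2]; split; rewrite /= sub0r normrN.
Qed.

(** * From the convexified to the graphical derivative *)

(** For every small [t], [proximal_trajectory] gives a graph point within [eps * t] of
    [(x, y) + t K]; compactness of the set of directions then yields a tangent vector in it. *)
Lemma convexified_criterion_graphical (R : realType) (X Y : normedModType R)
    (S H : X -> set Y) (xbar : X) (ybar : Y) :
  locally_closed S xbar ybar -> euclidean X -> euclidean Y -> prefan H ->
  derivative_criterion (convexified_graphical_derivative S) S H xbar ybar ->
  derivative_criterion (graphical_derivative S) S H xbar ybar.
Proof.
move=> clS eX eY [homH H0 cvH cpH finH] crit d d0.
have [ip ipP] := prod_inner_product eX eY.
have [M M0 HM] : exists2 M, 0 <= M & forall w z, H w z -> `|z| <= M * `|w|.
  by apply: outer_norm_bound => //; rewrite ltey_eq finH.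
have [e [r [r0 re clC critr]]] := derivative_criterion_nbhs clS crit d0.
set B0 := closed_ball_ _ _ _ in clC.
have cC : compact (gph S `&` B0).
  have cB0 : compact B0.
    exact: (@finite_dimensional_prod_compact_ball R X Y _ e eX.1 eY.1).
  by apply: (subclosed_compact clC cB0) => z [].
have tC z : `|z - (xbar, ybar)| < r ->
    tangent_cone (gph S `&` B0) z = tangent_cone (gph S) z.
  by move=> zr; apply/tangent_coneI_nbhs/nbhs_closed_ball_/(lt_le_trans zr).
exists (ball xbar (r / 2)), (ball ybar (r / 2)).
have r20 : 0 < r / 2 by rewrite divr_gt0.
split; [exact: nbhsx_ballx|exact: nbhsx_ballx|].
move=> x y p [Sxy []]; rewrite -!ball_normE /ball_/= => xr yr p0.
have zr : `|(x, y) - (xbar, ybar)| < r / 2.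
  by rewrite prod_norm_lt/= distrC xr distrC yr.
have zr' : `|(x, y) - (xbar, ybar)| < r by lra.
have Cz : (gph S `&` B0) (x, y).
  by split => //; rewrite /B0 /closed_ball_/= distrC (le_trans (ltW zr')).
pose N := (1 + M + d) * `|p|.
have N0 : 0 < N by rewrite mulr_gt0 ?normr_gt0//; lra.
have [||[_ _] [[w Hw [<- <-]] tw]] := @compact_meets_tangent_cone R _
    (gph S `&` B0) (opp_direction_set H d p) (x, y).
- by apply: opp_direction_set_compact; [exact: eY.1|].
- move=> eps eps0.
  (* The factor 3 is [B + 1] for the product inner product, where [B = 2]; the projections then stay
     within [r / 4] of [(x, y)]. *)
  pose t := Num.min (eps / 2) (r / 4 / (N * 3)).
  have t0 : 0 < t by rewrite lt_min !divr_gt0// mulr_gt0.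
  have te : t < eps.
    by rewrite (@le_lt_trans _ _ (eps / 2))// ?ge_min ?lexx//; lra.
  have tr : t * N * (2 + 1) <= r / 4.
    have -> : t * N * (2 + 1) = t * (N * 3) by ring.
    have N30 : 0 < N * 3 by rewrite mulr_gt0.
    by rewrite -(ler_pdivlMr _ _ N30) /t ge_min lexx orbT.
  have [||z [k [Cz' Kk zk]]] := @proximal_trajectory R _ 2 ip ipP
    (gph S `&` B0) (opp_direction_set H d p) (x, y) N (r / 4) eps t cC
    (opp_direction_set_convex (ltW d0) cvH)
    (fun k => @opp_direction_set_bound R X Y H d M p k (ltW d0) M0 HM)
    (ltW N0) _ eps0 t0 tr Cz; [by lra| |].
    move=> z [Sz _] zxy.
    have zbar : `|z - (xbar, ybar)| < r.
      have -> : z - (xbar, ybar) = (z - (x, y)) + ((x, y) - (xbar, ybar)).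
        by rewrite addrA subrK.
      by rewrite (le_lt_trans (ler_normD _ _))//; lra.
    have [q Dq Hq] := critr z p Sz zbar p0.
    by exists (p, q); split => //; rewrite tC//; case: (z) Dq.
  by exists t, z, k; rewrite t0 te.
exists (- w); split; last by exists w.
by rewrite tC in tw.
Qed.

(** * The claims (a), (b) and (c) *)

Theorem theorem2p2 (R : realType) (X : normedModType R)
    (Y : completeNormedModType R) (S H : X -> set Y) (xbar : X) (ybar : Y)
    (gphS : gph S (xbar, ybar))
    (closedS : locally_closed S xbar ybar)
    (homH : pos_homogeneous H) :
  let st1 := pseudo_strictly_differentiable S H xbar ybar in
  let st2 := derivative_criterion (graphical_derivative S) S H xbar ybar in
  let st2' :=
    derivative_criterion (convexified_graphical_derivative S) S H xbar ybar in
  [/\ finite_dimensional Y -> compact_valued H -> st1 -> st2,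
      (outer_norm H < +oo)%E -> convex_valued H -> complete_space X ->
        st2 -> st1 &
      euclidean X -> euclidean Y -> prefan H ->
        (st1 <-> st2) /\ (st2 <-> st2')].
Proof.
move=> st1 st2 st2'.
have cY : complete_space Y by move=> F PF; exact: cauchy_cvg.
split.
- by move=> fdY cH; exact: pseudo_strict_diff_criterion.
- by move=> finH cvH cX; exact: criterion_pseudo_strict_diff.
move=> eX eY pfH; have [_ _ cvH cpH finH] := pfH; split; split.
- by apply: pseudo_strict_diff_criterion => //; exact: eY.1.
- apply: criterion_pseudo_strict_diff => //; first by rewrite ltey_eq finH.
  by apply: finite_dimensional_complete; exact: eX.1.
- move=> crit d d0; have [U [V [Ux Vy UV]]] := crit d d0.
  exists U, V; split => // x y p Sxy p0; have [q [Dq Hq]] := UV x y p Sxy p0.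
  exists q; split => //; apply: subset_closure.
  by apply: sub_gen_smallest.
- exact: convexified_criterion_graphical.
Qed.
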